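(* Let $n_1, n_2$ be positive integers and $d_1, d_2$ be non-negative integers such that $d_1 \ne d_2$ and $n_2 d_2 \ge n_1 d_1$. Then there exists a connected graph $G \in \mathcal{G}_{d_1,n_1,d_2,n_2}$ with $\rho(G) = \rho(\mathcal{M}_{d_1,n_1,d_2,n_2})$ if and only if all four of the conditions (i) $n_2 d_2 + n_1 d_1$ is even, (ii) $n_2$ divides $n_1 d_1$, (iii) $n_2 \ge d_1$, (iv) $n_2(n_2-1) \ge n_2 d_2 - n_1 d_1$ hold and, in addition, at least one of the following conditions holds: (a) $d_1, d_2 \ge 2$; (b) $n_1 = d_2 = 1$ and $n_2 = d_1 > 1$ (in which case $G$ is a star with the central vertex in $V_1$); (c) $n_2 = d_1 = 1$ and $n_1 = d_2 > 1$ (in which case $G$ is a star with the central vertex in $V_2$); (d) $d_1 = 1$, $n_2 = 2$, $d_2 > 1$ and $n_1 = 2(d_2-1)$ (in which case $G$ is a double star with the two centers in $V_2$); (e) $d_1 = 1$, $d_2 > 1$ and $n_2 d_2 - n_1 d_1 \ge 2 n_2$ (in which case the induced graph $G[V_2]$ is a regular graph of degree at least two, and each $V_2$ vertex is connected to $n_1/n_2$ leaves in $V_1$).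
   Context: $\mathcal{M}_{d_1,n_1,d_2,n_2}$ is the set of symmetric $n\times n$ real matrices with non-negative entries (diagonal entries may be non-zero), $n = n_1+n_2$, having $n_1$ rows of sum $d_1$ and $n_2$ rows of sum $d_2$; $\rho(\mathcal{M}_{d_1,n_1,d_2,n_2})$ is the minimum of the spectral radius $\rho(M)$ over $M$ in this (compact) set. $\mathcal{G}_{d_1,n_1,d_2,n_2}$ is the family of simple undirected graphs (not necessarily connected) on $n_1+n_2$ vertices with $n_1$ vertices of degree $d_1$ and $n_2$ vertices of degree $d_2$; $\rho(G)$ is the spectral radius of the adjacency matrix of $G$. For $G$ in this family, $V_i$ denotes the set of vertices of degree $d_i$, $i=1,2$, and $G[V_2]$ is the subgraph induced on $V_2$. A double star is a graph consisting of two adjacent centers, each joined to some leaves, with no other vertices or edges. *)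

(* Defs.v *)
From HB Require Import structures.
From mathcomp Require Import all_boot all_order all_algebra.
From mathcomp Require Import classical_sets reals.
From mathcomp Require Import complex.

Set Implicit Arguments.
Unset Strict Implicit.
Unset Printing Implicit Defensive.

Import Order.TTheory GRing.Theory Num.Theory.

Local Open Scope ring_scope.

(** * Matrices with two row sums *)

(* The largest modulus of a complex eigenvalue.  The set is finite, and it is
   nonempty for 0 < n, so its supremum is a maximum. *)
Definition spectral_radius (R : realType) (n : nat) (M : 'M[R]_n) : R :=
  sup [set r : R | exists2 z : R[i],
    eigenvalue (map_mx (real_complex R) M) z & r = Normc.normc z]%classic.

(* The two row counts express the intended partition of the rows only when
   d1 != d2; for d1 = d2 and positive n1, n2 no matrix satisfies them. *)
Definition two_row_sums (R : realType) (d1 n1 d2 n2 : nat)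
    (M : 'M[R]_(n1 + n2)) : Prop :=
  [/\ M^T = M,
      forall i j, 0 <= M i j,
      #|[set i | \sum_j M i j == d1%:R]%SET| = n1
    & #|[set i | \sum_j M i j == d2%:R]%SET| = n2].

(* The set of matrices is compact, so the infimum is a minimum. *)
Definition min_spectral_radius (R : realType) (d1 n1 d2 n2 : nat) : R :=
  inf [set r : R | exists2 M : 'M[R]_(n1 + n2),
    two_row_sums d1 d2 M & r = spectral_radius M]%classic.

(** * Graphs, given by their adjacency relation *)

Definition simple_graph (T : finType) (e : rel T) : Prop :=
  symmetric e /\ irreflexive e.

Definition graph_connected (T : finType) (e : rel T) : Prop :=
  forall u v : T, connect e u v.

Definition degree (T : finType) (e : rel T) (v : T) : nat :=
  #|[set w | e v w]%SET|.

Definition degree_class (T : finType) (e : rel T) (d : nat) : {set T} :=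
  [set v | degree e v == d]%SET.

Definition adjacency_mx (R : realType) (n : nat) (e : rel 'I_n) : 'M[R]_n :=
  \matrix_(i, j) (e i j)%:R.

Definition graph_spectral_radius (R : realType) (n : nat) (e : rel 'I_n) : R :=
  spectral_radius (adjacency_mx R e).

(* As for matrices, meant for d1 != d2. *)
Definition two_degrees (d1 n1 d2 n2 : nat) (e : rel 'I_(n1 + n2)) : Prop :=
  [/\ simple_graph e,
      #|degree_class e d1| = n1
    & #|degree_class e d2| = n2].

Definition induced (T : finType) (e : rel T) (A : {set T}) :
    rel {x : T | x \in A} :=
  fun u v => e (val u) (val v).
Arguments induced {T} e A.

Definition regular (T : finType) (e : rel T) (r : nat) : Prop :=
  forall v : T, degree e v = r.

Definition is_star (T : finType) (e : rel T) (c : T) : Prop :=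
  forall u v : T, e u v = (u == c) (+) (v == c).

Definition leaf_of (T : finType) (e : rel T) (c u : T) : Prop :=
  forall w : T, e u w = (w == c).

(* Every vertex other than the two centers is a leaf of one of them, and each
   center has at least one leaf. *)
Definition is_double_star (T : finType) (e : rel T) (c1 c2 : T) : Prop :=
  [/\ c1 != c2 /\ e c1 c2,
      forall u, u != c1 -> u != c2 -> leaf_of e c1 u \/ leaf_of e c2 u,
      exists u, [/\ u != c1, u != c2 & leaf_of e c1 u]
    & exists u, [/\ u != c1, u != c2 & leaf_of e c2 u]].

(** * Numerical conditions *)

(* The subtraction is truncated, hence exact when n1 * d1 <= n2 * d2; the
   same holds for the subtractions below. *)
Definition feasible (d1 n1 d2 n2 : nat) : Prop :=
  [/\ ~~ odd (n2 * d2 + n1 * d1),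
      (n2 %| n1 * d1)%N,
      (d1 <= n2)%N
    & (n2 * d2 - n1 * d1 <= n2 * (n2 - 1))%N].

Definition case_a (d1 d2 : nat) : Prop := (2 <= d1)%N /\ (2 <= d2)%N.

Definition case_b (d1 n1 d2 n2 : nat) : Prop :=
  [/\ n1 = 1%N, d2 = 1%N, n2 = d1 & (1 < d1)%N].

Definition case_c (d1 n1 d2 n2 : nat) : Prop :=
  [/\ n2 = 1%N, d1 = 1%N, n1 = d2 & (1 < d2)%N].

Definition case_d (d1 n1 d2 n2 : nat) : Prop :=
  [/\ d1 = 1%N, n2 = 2%N, (1 < d2)%N & n1 = (2 * (d2 - 1))%N].

Definition case_e (d1 n1 d2 n2 : nat) : Prop :=
  [/\ d1 = 1%N, (1 < d2)%N & (2 * n2 <= n2 * d2 - n1 * d1)%N].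

(* Main.v *)
Require Import Defs.
From mathcomp Require Import classical_sets reals complex.
From mathcomp Require Import all_boot all_order all_algebra.
From mathcomp Require Import zify ring lra.

Set Implicit Arguments.
Unset Strict Implicit.
Unset Printing Implicit Defensive.

(** Let [V1] be the set of [n1] rows of sum [d1], and suppose [d1 > 0].  For a vector
    [x] that is constant on [V1] and on its complement, the form [x M x^T] depends
    on [M] only through the mass [m] of the block on [V1].  Let [lam] be the Perron
    root of the quotient matrix with [m = 0], where the rows outside [V1] all have
    mass [n1 d1 / n2] in [V1], and let [x] be its positive eigenvector.  Then
      [x M x^T = lam |x|^2 + m (d1 - lam)^2]
    ([extremal_quadratic_form]).  So the Rayleigh quotient gives
    [lam <= spectral_radius M], with equality exactly when [m = 0] and [x] is an
    eigenvector of [M] ([spectral_radius_eq_rootP]); a matrix constant on the four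
    blocks attains [lam], which is therefore the minimum.

    For graphs this says ([graph_spectral_radius_minP]): the minimum is reached iff
    [V1] is independent and each vertex outside [V1] has exactly [b = n1 d1 / n2]
    neighbors in [V1], hence [r = d2 - b] outside.  The four feasibility conditions
    are then the handshake lemma, the integrality of [b], and the trivial bounds on
    degrees into the second class.  If [d1 = 1] or [d2 = 1], one class consists of
    leaves and connectivity leaves only a star, a double star, or a connected
    regular graph with equally many leaves at each vertex.

    Conversely a connected graph of this form is built from a biregular bipartite
    graph and an [r]-regular graph on the second class.  If [r >= 2] or
    [r = n2 - 1], an [r]-regular circulant connects the second class; if [n1 = 1],
    the vertex of [V1] is joined to all others.  If [b, d1 >= 2] the bipartite part
    can be made connected by placing the neighborhoods of [V1] as consecutive
    cyclic intervals ([slot_chain]).  In the remaining case [b = r = 1] the first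
    class is connected through the edges of a perfect matching of the second
    ([extremal_matching_graph]).

    For [d1 = 0] there are isolated vertices, so no graph is connected, and each of
    the five cases fails. *)

(** * Spectral radius and Rayleigh quotient of symmetric matrices *)

Section Spectral.
Import Order.TTheory GRing.Theory Num.Theory.
Local Open Scope ring_scope.
Variable R : realType.

Lemma normc_normE (z : R[i]) : `|z| = (Normc.normc z)%:C%C.
Proof. by []. Qed.

(** The Collatz-Wielandt bound: for an eigenvector [v], pairing the inequality
    [|z| |v_j| <= \sum_i |v_i| |M i j|] with the positive weights [x] gives
    [|z| \sum |v_j| x_j <= lam \sum |v_i| x_i], and the common sum is positive. *)
Lemma normc_eigenvalue_le n (M : 'M[R]_n) (x : 'I_n -> R) (lam : R) (z : R[i]) :
    (forall i, 0 < x i) ->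
    (forall i, \sum_j `|M i j| * x j <= lam * x i) ->
  eigenvalue (map_mx (real_complex R) M) z -> Normc.normc z <= lam.
Proof.
move=> x_gt0 Mx /eigenvalueP[v vM v_neq0].
pose w i : R := Normc.normc (v 0 i).
have w_ge0 i : 0 <= w i by rewrite -ler0c -normc_normE.
have sum_gt0 : 0 < \sum_i w i * x i.
  have s0 : 0 <= \sum_i w i * x i.
    by apply: sumr_ge0 => i _; rewrite mulr_ge0 // ltW.
  rewrite lt_neqAle s0 andbT; apply: contra v_neq0 => /eqP/esym/eqP.
  rewrite psumr_eq0 => [/allP w0|i _]; last by rewrite mulr_ge0 // ltW.
  apply/eqP/rowP => i; rewrite mxE.
  have := w0 i (mem_index_enum i); rewrite mulf_eq0 (gt_eqF (x_gt0 i)) orbF.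
  by move=> /eqP /Normc.eq0_normc.
have step j : Normc.normc z * w j <= \sum_i w i * `|M i j|.
  rewrite -lecR -Normc.normcM -normc_normE.
  move/rowP/(_ j): vM; rewrite !mxE => <-.
  apply: le_trans (ler_norm_sum _ _ _) _.
  rewrite rmorph_sum; apply: ler_sum => i _.
  by rewrite mxE normrM rmorphM normc_normE !normc_normE /= expr0n /= addr0 sqrtr_sqr.
rewrite -(ler_pM2r sum_gt0) mulr_sumr.
apply: (@le_trans _ _ (\sum_j \sum_i w i * `|M i j| * x j)).
  apply: ler_sum => j _; rewrite mulrA -mulr_suml.
  by apply: ler_wpM2r; [exact: ltW | exact: step].
rewrite exchange_big /= mulr_sumr; apply: ler_sum => i _.
under eq_bigr do rewrite -mulrA.
by rewrite -mulr_sumr mulrCA ler_wpM2l.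
Qed.

Lemma normc_eigenvalue_le_spectral_radius n (M : 'M[R]_n) (z : R[i]) :
  eigenvalue (map_mx (real_complex R) M) z ->
  Normc.normc z <= spectral_radius M.
Proof.
move=> ez; apply: sup_ubound; last by exists z.
(* weights 1 and the total absolute mass bound the set, so its supremum is real *)
exists (\sum_i \sum_j `|M i j|) => _ [y ey ->].
apply: (@normc_eigenvalue_le _ M (fun=> 1) _ y _ _ ey) => // i.
under eq_bigr do rewrite mulr1.
rewrite mulr1 [leRHS](bigD1 i) //= lerDl.
by apply: sumr_ge0 => k _; apply: sumr_ge0 => j _.
Qed.

(** Perron-Frobenius in its easy direction: a positive eigenvector serves as the
    weights that bound every eigenvalue by its own. *)
Lemma spectral_radius_pos_eigenvector n (M : 'M[R]_n) (x : 'I_n -> R) (lam : R) :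
    (0 < n)%N -> M^T = M -> (forall i j, 0 <= M i j) -> (forall i, 0 < x i) ->
    (forall i, \sum_j M i j * x j = lam * x i) ->
  spectral_radius M = lam.
Proof.
move=> n_gt0 Msym M_ge0 x_gt0 Mx.
have bound z : eigenvalue (map_mx (real_complex R) M) z -> Normc.normc z <= lam.
  apply: (normc_eigenvalue_le x_gt0) => i.
  by under eq_bigr do rewrite ger0_norm //; rewrite Mx.
pose i0 := Ordinal n_gt0.
have lam_ge0 : 0 <= lam.
  rewrite -(pmulr_lge0 _ (x_gt0 i0)) -Mx sumr_ge0 // => j _.
  by rewrite mulr_ge0 // ltW.
have elam : eigenvalue (map_mx (real_complex R) M) lam%:C%C.
  apply/eigenvalueP; exists (\row_j (x j)%:C%C).
    apply/rowP => j; rewrite !mxE -rmorphM -Mx rmorph_sum; apply: eq_bigr => i _.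
    by rewrite !mxE rmorphM mulrC /= -{1}Msym mxE.
  apply/eqP => /rowP/(_ i0); rewrite !mxE => /complexI x0.
  by have := x_gt0 i0; rewrite x0 ltxx.
have normlam : Normc.normc lam%:C%C = lam.
  by rewrite /= expr0n addr0 sqrtr_sqr ger0_norm.
apply/eqP; rewrite eq_le -{2}normlam normc_eigenvalue_le_spectral_radius // andbT.
apply: ge_sup; first by exists lam, lam%:C%C.
by move=> _ [z ez ->]; apply: bound.
Qed.

(** Unitary diagonalization over [R[i]]: in the coordinates [y] of [x] in an
    eigenbasis the form is [\sum_i d_i |y_i|^2], and each [d_i] is an
    eigenvalue, hence bounded by the spectral radius. *)
Lemma rayleigh_le n (M : 'M[R]_n) (x : 'I_n -> R) : M^T = M ->
  \sum_i \sum_j x i * M i j * x j <= spectral_radius M * \sum_i x i ^+ 2.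
Proof.
move=> Msym.
pose C := R[i]; pose Mc : 'M[C]_n := map_mx (real_complex R) M.
pose xc : 'rV[C]_n := \row_i (x i)%:C%C.
have conjR (a : R) : (a%:C%C : C)^* = a%:C%C.
  by apply/CrealP; apply/complex_realP; exists a.
have Mherm : Mc \is hermsymmx.
  apply/is_hermitianmxP; rewrite expr0 scale1r.
  by apply/matrixP => i j; rewrite !mxE conjR -{1}Msym mxE.
have /orthomx_spectralP := hermitian_normalmx Mherm.
set P := spectralmx Mc; set d := spectral_diag Mc => McE.
have Punit : P \in unitmx := spectral_unit Mc.
have Pinv : invmx P = map_mx Num.conj P^T.
  by rewrite invmx_unitary // spectral_unitarymx.
have d_eigen i : eigenvalue Mc (d 0 i).
  apply/eigenvalueP; exists (row i P).
    rewrite {1}McE -row_mul !mulmxA mulmxV // mul1mx row_mul.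
    by rewrite row_diag_mx -scalemxAl -rowE.
  apply/eqP => Pi0; have : row i (P *m invmx P) 0 i = 0.
    by rewrite row_mul Pi0 mul0mx mxE.
  by rewrite mulmxV // !mxE eqxx => /eqP; rewrite oner_eq0.
pose y := xc *m invmx P.
(* [x] is real, so the right-hand coordinates are the conjugates of [y] *)
have yconj : P *m xc^T = map_mx Num.conj y^T.
  rewrite /y Pinv trmx_mul map_mxM; congr (_ *m _); apply/matrixP => i j.
    by rewrite !mxE; apply/esym/conjCK.
  by rewrite !mxE; apply/esym/conjR.
have quadE : (\sum_i \sum_j x i * M i j * x j)%:C%C
           = \sum_i d 0 i * `|y 0 i| ^+ 2.
  transitivity ((xc *m Mc *m xc^T) 0 0).
    rewrite exchange_big mxE rmorph_sum; apply: eq_bigr => j _.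
    rewrite rmorph_sum mxE mulr_suml; apply: eq_bigr => i _.
    by rewrite !mxE !rmorphM.
  rewrite McE !mulmxA -/y -mulmxA yconj mxE; apply: eq_bigr => i _.
  by rewrite mul_mx_diag !mxE normCK mulrAC [RHS]mulrC.
have normE : (\sum_i x i ^+ 2)%:C%C = \sum_i `|y 0 i| ^+ 2.
  transitivity ((xc *m xc^T) 0 0).
    rewrite mxE rmorph_sum; apply: eq_bigr => i _.
    by rewrite !mxE -rmorphM expr2.
  rewrite -{1}[xc](mulmxKV Punit) -/y -mulmxA yconj mxE.
  by apply: eq_bigr => i _; rewrite !mxE normCK.
rewrite -lecR rmorphM /= normE quadE mulr_sumr.
have quad_ge0 : \sum_i d 0 i * `|y 0 i| ^+ 2 \is Num.real.
  by rewrite -quadE; apply/complex_realP; eexists.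
apply: le_trans (real_ler_norm quad_ge0) _.
apply: le_trans (ler_norm_sum _ _ _) _; apply: ler_sum => i _.
rewrite normrM normrX normr_id ler_wpM2r ?exprn_ge0 // normc_normE lecR.
exact: normc_eigenvalue_le_spectral_radius.
Qed.

(** A maximizer of the Rayleigh quotient is a critical point: moving [x] along the
    defect [g = M x - rho x] changes the form minus [rho |x|^2] by
    [2 t |g|^2 + O(t^2)], which cannot stay nonpositive near [t = 0] unless
    [g = 0]. *)
Lemma rayleigh_eq_eigenvector n (M : 'M[R]_n) (x : 'I_n -> R) : M^T = M ->
    \sum_i \sum_j x i * M i j * x j = spectral_radius M * \sum_i x i ^+ 2 ->
  forall i, \sum_j M i j * x j = spectral_radius M * x i.
Proof.
move=> Msym xmax i; set rho := spectral_radius M.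
pose g k := \sum_j M k j * x j - rho * x k.
pose G := \sum_k g k ^+ 2; pose Q := \sum_k \sum_j g k * M k j * g j - rho * \sum_k g k ^+ 2.
have var t : t * G *+ 2 + t ^+ 2 * Q <= 0.
  have := rayleigh_le (fun k => x k + t * g k) Msym; rewrite -/rho -subr_le0.
  apply: le_trans.
  have quadD : \sum_k \sum_j (x k + t * g k) * M k j * (x j + t * g j)
     = \sum_k \sum_j x k * M k j * x j
       + (t * \sum_k g k * \sum_j M k j * x j) *+ 2
       + t ^+ 2 * \sum_k \sum_j g k * M k j * g j.
    have sw : \sum_k g k * (\sum_j M k j * x j) = \sum_k \sum_j x k * M k j * g j.
      rewrite exchange_big /=; apply: eq_bigr => k _; rewrite mulr_sumr.
      by apply: eq_bigr => j _; rewrite -{1}Msym mxE; ring.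
    rewrite mulr2n {2}sw !mulr_sumr -!big_split /=.
    apply: eq_bigr => k _; rewrite mulr_sumr !mulr_sumr -!big_split /=.
    by apply: eq_bigr => j _; ring.
  have sqD : \sum_k (x k + t * g k) ^+ 2 = \sum_k x k ^+ 2
     + (t * \sum_k g k * x k) *+ 2 + t ^+ 2 * \sum_k g k ^+ 2.
    rewrite mulr2n !mulr_sumr -!big_split /=.
    by apply: eq_bigr => k _; ring.
  rewrite /G /Q quadD sqD xmax -/rho.
  have -> : \sum_k g k ^+ 2 = \sum_k g k * (\sum_j M k j * x j) - rho * \sum_k g k * x k.
    rewrite mulr_sumr -sumrB; apply: eq_bigr => k _; rewrite expr2 {2}/g mulrBr.
    by congr (_ - _); ring.
  rewrite le_eqVlt; apply/orP; left; apply/eqP; ring.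
have G_ge0 : 0 <= G by apply: sumr_ge0 => k _; apply: sqr_ge0.
have G0 : G = 0.
  apply/eqP; rewrite eq_le G_ge0 andbT leNgt; apply/negP => G_gt0.
  have [Q_ge0|Q_lt0] := lerP 0 Q.
    by have := var 1; rewrite expr1n !mul1r; lra.
  (* the maximum of the concave quadratic is at t = - G / Q, where it is positive *)
  have := var (- G / Q); have -> : (- G / Q * G) *+ 2 + (- G / Q) ^+ 2 * Q = - (G ^+ 2 / Q).
    by field; rewrite lt_eqF.
  rewrite oppr_le0 pmulr_rge0 ?exprn_gt0 // invr_ge0; lra.
move/eqP: G0; rewrite psumr_eq0 => [/allP g0|k _]; last exact: sqr_ge0.
by have := g0 i (mem_index_enum i); rewrite sqrf_eq0 subr_eq0 => /eqP.
Qed.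
End Spectral.

(** * The minimum over matrices with two row sums *)

Lemma two_valued_by_count (I : finType) (T : eqType) (f : I -> T) (a b : T) :
    a != b -> #|[set i | f i == a]| + #|[set i | f i == b]| = #|I| ->
  forall i, (f i == b) = (f i != a).
Proof.
move=> ab cards i.
have disj : [set i | f i == a] :&: [set i | f i == b] = set0.
  apply/setP => k; rewrite !inE; apply/negP => /andP[/eqP -> ].
  exact/negP.
have full : [set i | f i == a] :|: [set i | f i == b] = [set: I].
  by apply/eqP; rewrite eqEcard subsetT cardsT cardsU disj cards0 subn0 cards leqnn.
have := in_setT i; rewrite -full !inE.
case: (eqVneq (f i) a) => [->|_ /= ->] // _.
by rewrite (negbTE ab).
Qed.

Lemma card_set_split n1 n2 (P : pred 'I_(n1 + n2)) :
  #|[set i | P i]| = #|[set i | P (lshift n2 i)]| + #|[set j | P (rshift n1 j)]|.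
Proof. by rewrite -!sum1dep_card big_mkcond big_split_ord -!big_mkcond. Qed.

Section Extremal.
Import Order.TTheory GRing.Theory Num.Theory.
Local Open Scope ring_scope.
Variables (R : realType) (d1 n1 d2 n2 : nat).
Hypotheses (n1_gt0 : (0 < n1)%N) (n2_gt0 : (0 < n2)%N) (d1_gt0 : (0 < d1)%N).
Hypotheses (d1_neq_d2 : d1 <> d2) (le_n1d1_n2d2 : (n1 * d1 <= n2 * d2)%N).

(** The quadratic is the characteristic equation, multiplied by [n2], of the
    quotient matrix [[0, d1], [c, d2 - c]] with [c = n1 d1 / n2]: all mass of the
    [d1]-rows sits in the [d2]-columns.  The value [lam = d1] would force
    [d1 = d2]. *)
Lemma extremal_root : exists lam : R, [/\ 0 < lam, lam != d1%:R &
  n2%:R * lam ^+ 2 = (n2%:R * d2%:R - n1%:R * d1%:R) * lam + n1%:R * d1%:R ^+ 2].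
Proof.
pose b : R := n2%:R * d2%:R - n1%:R * d1%:R.
pose c : R := n1%:R * d1%:R ^+ 2.
have b_ge0 : 0 <= b by rewrite subr_ge0 -!natrM ler_nat.
have c_gt0 : 0 < c by rewrite mulr_gt0 ?exprn_gt0 ?ltr0n.
have a_gt0 : 0 < n2%:R :> R by rewrite ltr0n.
pose D := b ^+ 2 + 4 * n2%:R * c.
have D_gt0 : 0 < D by rewrite /D ltr_wpDl ?sqr_ge0 // mulr_gt0 // mulr_gt0 ?ltr0n.
pose s := Num.sqrt D.
have s2 : s ^+ 2 = D by rewrite sqr_sqrtr // ltW.
have s_gt0 : 0 < s by rewrite sqrtr_gt0.
have root : n2%:R * ((b + s) / (2 * n2%:R)) ^+ 2 = b * ((b + s) / (2 * n2%:R)) + c.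
  have -> : n2%:R * ((b + s) / (2 * n2%:R)) ^+ 2
          = (b ^+ 2 + 2 * b * s + s ^+ 2) / (4 * n2%:R).
    by field; rewrite gt_eqF.
  by rewrite s2 /D; field; rewrite gt_eqF.
exists ((b + s) / (2 * n2%:R)); split=> //.
  by rewrite divr_gt0 ?ltr_wpDl // mulr_gt0.
apply/eqP => lamE; move: root; rewrite lamE /b /c => /eqP.
rewrite -subr_eq0.
have -> : n2%:R * d1%:R ^+ 2 - ((n2%:R * d2%:R - n1%:R * d1%:R) * d1%:R
     + n1%:R * d1%:R ^+ 2) = n2%:R * d1%:R * (d1%:R - d2%:R) :> R by ring.
rewrite !mulf_eq0 !pnatr_eq0 (gtn_eqF n2_gt0) (gtn_eqF d1_gt0) /= subr_eq0 eqr_nat.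
by move/eqP.
Qed.

Variable lam : R.
Hypotheses (lam_gt0 : 0 < lam) (lam_neq_d1 : lam != d1%:R).
Hypothesis lamE :
  n2%:R * lam ^+ 2 = (n2%:R * d2%:R - n1%:R * d1%:R) * lam + n1%:R * d1%:R ^+ 2.

Definition row_class (M : 'M[R]_(n1 + n2)) (d : nat) : {set 'I_(n1 + n2)} :=
  [set i | \sum_j M i j == d%:R].

(** The equality case of the lower bound: the two row classes form an equitable
    partition that carries as much mass as possible across. *)
Definition extremal_pattern (M : 'M[R]_(n1 + n2)) : Prop :=
  (forall i j, i \in row_class M d1 -> j \in row_class M d1 -> M i j = 0) /\
  (forall i, i \notin row_class M d1 ->
     n2%:R * \sum_(j in row_class M d1) M i j = n1%:R * d1%:R).

Section OneMatrix.
Variable M : 'M[R]_(n1 + n2).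
Hypothesis M_rows : two_row_sums d1 d2 M.

Let V1 := row_class M d1.
Let chi i : R := (i \in V1)%:R.
(* the eigenvector of the quotient matrix: d1 on V1, lam elsewhere *)
Let x i : R := lam + (d1%:R - lam) * chi i.

Let Msym : M^T = M. Proof. by case: M_rows. Qed.
Let M_ge0 i j : 0 <= M i j. Proof. by case: M_rows. Qed.

Let row_sumE i : \sum_j M i j = d2%:R + (d1%:R - d2%:R) * chi i.
Proof.
case: M_rows => _ _ c1 c2.
have := @two_valued_by_count _ _ (fun i => \sum_j M i j) d1%:R d2%:R.
rewrite eqr_nat => /(_ (introN eqP d1_neq_d2)).
rewrite c1 c2 card_ord => /(_ erefl i).
rewrite /chi inE; case: (eqVneq (\sum_j M i j) d1%:R) => [-> _|_ /= /eqP ->];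
  rewrite /= ?mulr1n ?mulr0n; ring.
Qed.

Let chi_sq i : chi i ^+ 2 = chi i.
Proof. by rewrite /chi; case: (_ \in _); rewrite ?expr1n ?expr0n. Qed.

Let sum_chi (a b : R) : \sum_i (a + b * chi i) = a * (n1%:R + n2%:R) + b * n1%:R.
Proof.
rewrite big_split /= sumr_const card_ord -[a *+ _]mulr_natr natrD; congr (_ + _).
have cardV1 : #|V1| = n1 by case: M_rows.
rewrite -mulr_sumr -[in RHS]cardV1 -sum1_card natr_sum [in RHS]big_mkcond.
by congr (_ * _); apply: eq_bigr => i _; rewrite /chi; case: ifP.
Qed.

Let sum_V1 (F : 'I_(n1 + n2) -> R) : \sum_(j in V1) F j = \sum_j F j * chi j.
Proof.
rewrite big_mkcond; apply: eq_bigr => j _; rewrite /chi.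
by case: ifP; rewrite ?mulr1 ?mulr0.
Qed.

Let x_sumsq : \sum_i x i ^+ 2 = n1%:R * d1%:R ^+ 2 + n2%:R * lam ^+ 2.
Proof.
transitivity (\sum_i (lam ^+ 2 + (d1%:R ^+ 2 - lam ^+ 2) * chi i)).
  by apply: eq_bigr => i _; rewrite /x sqrrD exprMn chi_sq; ring.
rewrite sum_chi; ring.
Qed.

(** With [x = lam 1 + (d1 - lam) chi], the form only sees the total mass, the mass
    of the [d1]-rows and the mass of the block on [V1]; the row sums fix the first
    two, so only the last one depends on the matrix. *)
Lemma extremal_quadratic_form :
  \sum_i \sum_j x i * M i j * x j =
  lam * (\sum_i x i ^+ 2)
  + (d1%:R - lam) ^+ 2 * \sum_(i in V1) \sum_(j in V1) M i j.
Proof.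
have q1 : \sum_i \sum_j M i j = n1%:R * d1%:R + n2%:R * d2%:R.
  under eq_bigr do rewrite row_sumE; rewrite sum_chi; ring.
have q2 : \sum_i chi i * \sum_j M i j = n1%:R * d1%:R.
  transitivity (\sum_i (0 + d1%:R * chi i)).
    apply: eq_bigr => i _; rewrite row_sumE mulrDr mulrCA -expr2 chi_sq; ring.
  rewrite sum_chi; ring.
have q3 : \sum_i \sum_j M i j * chi j = n1%:R * d1%:R.
  rewrite exchange_big -[RHS]q2 /=; apply: eq_bigr => j _.
  by rewrite mulr_sumr; apply: eq_bigr => i _; rewrite -{1}Msym mxE mulrC.
transitivity (lam ^+ 2 * (\sum_i \sum_j M i j)
  + lam * (d1%:R - lam) * (\sum_i chi i * \sum_j M i j)
  + lam * (d1%:R - lam) * (\sum_i \sum_j M i j * chi j)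
  + (d1%:R - lam) ^+ 2 * \sum_(i in V1) \sum_(j in V1) M i j).
  rewrite sum_V1 !mulr_sumr -!big_split; apply: eq_bigr => i _ /=.
  rewrite sum_V1 mulr_suml !mulr_sumr -!big_split; apply: eq_bigr => j _ /=.
  rewrite /x; ring.
rewrite q1 q2 q3 x_sumsq; congr (_ + _).
have -> : lam * (n1%:R * d1%:R ^+ 2 + n2%:R * lam ^+ 2)
        = lam * (n1%:R * d1%:R ^+ 2) + lam * (n2%:R * lam ^+ 2) by ring.
rewrite lamE; ring.
Qed.

Let mass_ge0 : 0 <= \sum_(i in V1) \sum_(j in V1) M i j.
Proof. by apply: sumr_ge0 => i _; apply: sumr_ge0 => j _. Qed.

Let x_gt0 i : 0 < x i.
Proof.
rewrite /x /chi; case: (_ \in _); rewrite ?mulr1 ?mulr0 ?addr0 //.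
by rewrite addrC subrK ltr0n.
Qed.

Let x_sumsq_gt0 : 0 < \sum_i x i ^+ 2.
Proof.
by rewrite x_sumsq ltr_wpDl ?mulr_gt0 ?mulr_ge0 ?exprn_gt0 ?exprn_ge0 ?ler0n ?ltr0n
           // ltW.
Qed.

Lemma spectral_radius_ge_root : lam <= spectral_radius M.
Proof.
rewrite -(ler_pM2r x_sumsq_gt0); apply: le_trans (rayleigh_le x Msym).
by rewrite extremal_quadratic_form lerDl mulr_ge0 ?sqr_ge0.
Qed.

Let row_mul_x i :
  \sum_j M i j * x j = lam * (\sum_j M i j) + (d1%:R - lam) * \sum_(j in V1) M i j.
Proof.
rewrite sum_V1 !mulr_sumr -big_split; apply: eq_bigr => j _ /=; rewrite /x; ring.
Qed.

(** Equality in the bound kills the block on [V1] and makes [x] an eigenvector.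
    Since [x] takes two different values, the eigenvector equation at a row
    outside [V1] determines the mass this row sends into [V1].  Conversely the
    pattern makes [x] a positive eigenvector for [lam]. *)
Lemma spectral_radius_eq_rootP : spectral_radius M = lam <-> extremal_pattern M.
Proof.
have d1lam : d1%:R - lam != 0 by rewrite subr_eq0 eq_sym.
have n2R : n2%:R != 0 :> R by rewrite pnatr_eq0 -lt0n.
split=> [rhoE|[V1_indep V2_rows]].
  have q := rayleigh_le x Msym.
  have mass0 : \sum_(i in V1) \sum_(j in V1) M i j = 0.
    apply/eqP; rewrite eq_le mass_ge0 andbT.
    move: q; rewrite extremal_quadratic_form rhoE gerDl pmulr_rle0 //.
    by rewrite lt_neqAle sqr_ge0 andbT eq_sym sqrf_eq0.
  have eig := rayleigh_eq_eigenvector Msym.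
  have {}eig i : \sum_j M i j * x j = lam * x i.
    rewrite -rhoE; apply: eig.
    by rewrite extremal_quadratic_form mass0 mulr0 addr0 rhoE.
  split=> [i j iV1 jV1|i iV2].
    move/eqP: mass0; rewrite psumr_eq0 => [/allP m0|k _]; last exact: sumr_ge0.
    have /implyP/(_ iV1) := m0 i (mem_index_enum i).
    rewrite psumr_eq0 // => /allP m1.
    by have /implyP/(_ jV1)/eqP := m1 j (mem_index_enum j).
  have := eig i; rewrite row_mul_x row_sumE /x.
  have -> : chi i = 0 by rewrite /chi (negbTE iV2).
  rewrite !mulr0 !addr0 => e.
  apply: (mulfI d1lam); rewrite mulrCA.
  have -> : (d1%:R - lam) * (\sum_(j in V1) M i j) = lam * lam - lam * d2%:R.
    by rewrite -e [RHS]addrC addKr.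
  have -> : n2%:R * (lam * lam - lam * d2%:R)
          = n2%:R * lam ^+ 2 - n2%:R * lam * d2%:R by ring.
  rewrite lamE; ring.
apply: (spectral_radius_pos_eigenvector _ Msym M_ge0 x_gt0) => [|i].
  by rewrite addn_gt0 n1_gt0.
rewrite row_mul_x row_sumE /x.
have [iV1|iV2] := boolP (i \in V1).
  rewrite big1 => [|j jV1]; last exact: V1_indep.
  by rewrite /chi iV1 /= mulr1n; ring.
apply: (mulfI n2R); have := V2_rows i iV2; rewrite -/V1 => rowE.
rewrite mulrDr [n2%:R * (_ * \sum_(_ in _) _)]mulrCA rowE /chi (negbTE iV2).
rewrite !mulr0 !addr0 -expr2 lamE; ring.
Qed.

End OneMatrix.

(** Constant blocks work; the block outside [V1] is nonnegative because
    [n1 d1 <= n2 d2]. *)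
Lemma extremal_matrix :
  exists2 M : 'M[R]_(n1 + n2), two_row_sums d1 d2 M & extremal_pattern M.
Proof.
have n2R : n2%:R != 0 :> R by rewrite pnatr_eq0 -lt0n.
pose p : R := d1%:R / n2%:R.
pose q : R := (d2%:R - n1%:R * d1%:R / n2%:R) / n2%:R.
pose M : 'M[R]_(n1 + n2) := \matrix_(i, j)
  match split i, split j with inl _, inl _ => 0 | inr _, inr _ => q | _, _ => p end.
have split_l i : split (lshift n2 i) = inl i := unsplitK (inl i).
have split_r j : split (rshift n1 j) = inr j := unsplitK (inr j).
have rows_l i : \sum_j M (lshift n2 i) j = d1%:R.
  rewrite big_split_ord /= big1 => [|j _]; last by rewrite mxE !split_l.
  rewrite (eq_bigr (fun=> p)) => [|j _]; last by rewrite mxE split_l split_r.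
  by rewrite add0r sumr_const card_ord -[p *+ _]mulr_natr /p divfK.
have rows_r i : \sum_j M (rshift n1 i) j = d2%:R.
  rewrite big_split_ord /= (eq_bigr (fun=> p)) => [|j _]; last first.
    by rewrite mxE split_l split_r.
  rewrite [X in _ + X](eq_bigr (fun=> q)) => [|j _]; last by rewrite mxE !split_r.
  by rewrite !sumr_const !card_ord -[p *+ _]mulr_natr -[q *+ _]mulr_natr /p /q; field.
have d21 : (d2%:R == d1%:R :> R) = false.
  by rewrite eqr_nat eq_sym; apply/eqP.
have class1 : row_class M d1 = [set i | if split i is inl _ then true else false].
  apply/setP => i; rewrite !inE; case: (split_ordP i) => j ->.
    by rewrite rows_l eqxx.
  by rewrite rows_r d21.
exists M.
  split.
  - by apply/matrixP => i j; rewrite !mxE; case: (split i); case: (split j).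
  - move=> i j; rewrite mxE.
    have p_ge0 : 0 <= p by rewrite divr_ge0 ?ler0n.
    have q_ge0 : 0 <= q.
      rewrite divr_ge0 ?ler0n // subr_ge0 ler_pdivrMr ?ltr0n // -!natrM ler_nat.
      by rewrite [(d2 * _)%N]mulnC.
    by case: (split i); case: (split j).
  - rewrite card_set_split -[RHS]addn0; congr (_ + _)%N.
      by rewrite -[RHS]card_ord -cardsT; apply: eq_card => i; rewrite !inE rows_l eqxx.
    by apply/eqP; rewrite cards_eq0; apply/eqP/setP => i; rewrite !inE rows_r d21.
  - rewrite card_set_split -[RHS]add0n; congr (_ + _)%N.
      apply/eqP; rewrite cards_eq0; apply/eqP/setP => i.
      by rewrite !inE rows_l eq_sym d21.
    by rewrite -[RHS]card_ord -cardsT; apply: eq_card => i; rewrite !inE rows_r eqxx.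
rewrite /extremal_pattern class1; split=> [i j|i].
  rewrite !inE mxE; case: (split_ordP i) => i' _; case: (split_ordP j) => j' _ //.
rewrite inE; case: (split_ordP i) => i2 -> // _.
rewrite big_mkcond big_split_ord /= addrC big1 => [|j _].
  rewrite add0r (eq_bigr (fun=> p)) => [|j _].
    by rewrite sumr_const card_ord -[p *+ _]mulr_natr /p; field.
  by rewrite inE mxE split_l split_r.
by rewrite inE split_r.
Qed.

Lemma min_spectral_radius_root : min_spectral_radius R d1 n1 d2 n2 = lam.
Proof.
have [M M_rows M_pat] := extremal_matrix.
have rhoM : spectral_radius M = lam by apply/spectral_radius_eq_rootP.
have lb : lbound [set r : R | exists2 M : 'M[R]_(n1 + n2),
    two_row_sums d1 d2 M & r = spectral_radius M]%classic lam.
  by move=> _ [N N_rows ->]; apply: spectral_radius_ge_root.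
apply/eqP; rewrite eq_le; apply/andP; split.
  by apply: ge_inf; [exists lam | exists M].
by apply: lb_le_inf => //; exists lam, M.
Qed.
End Extremal.

(** * Graphs attaining the minimum *)

Section Graphs.
Variables (T : finType) (e : rel T).
Hypothesis e_simple : simple_graph e.

Let e_sym : symmetric e. Proof. by case: e_simple. Qed.
Let e_irr : irreflexive e. Proof. by case: e_simple. Qed.

Lemma even_sum_degree : ~~ odd (\sum_v degree e v).
Proof.
have degE v : degree e v = \sum_w e v w.
  by rewrite /degree -sum1dep_card big_mkcond.
under eq_bigr do rewrite degE.
(* orient each edge by the enumeration order of its ends *)
pose lo (v w : T) := enum_rank v < enum_rank w.
have -> : \sum_v \sum_w e v w = (\sum_v \sum_(w | lo v w) e v w).*2.
  rewrite -addnn [X in _ = _ + X](exchange_big_dep xpredT) //=.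
  rewrite -big_split /=; apply: eq_bigr => v _.
  rewrite (bigID (lo v)) /=; congr (_ + _).
  rewrite (bigD1 v) /lo ?ltnn //= e_irr add0n; apply: eq_big => w.
    by rewrite -leqNgt ltn_neqAle andbC (inj_eq val_inj) (inj_eq enum_rank_inj).
  by rewrite e_sym.
by rewrite odd_double.
Qed.

Lemma degree1_neighbor (u v w : T) : degree e u = 1 -> e u v -> e u w -> v = w.
Proof.
by move=> /eqP/cards1P[x Nu] uv uw; move/setP: Nu => Nu;
   move: (Nu v) (Nu w); rewrite !inE uv uw => /esym/eqP -> /esym/eqP ->.
Qed.

(** Pendant vertices do not help connectivity: adding to [W] the leaves attached
    to it gives a set closed under adjacency, hence everything. *)
Lemma connected_leaf_complement (P W : {set T}) (w0 : T) :
    graph_connected e -> w0 \in W ->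
    {in P & P, forall x y, ~~ e x y} ->
    (forall x, x \in P -> degree e x = 1) ->
    (forall x y, x \in W -> y \notin P -> e x y -> y \in W) ->
  forall v, v \notin P -> v \in W.
Proof.
move=> conn w0W P_indep P_leaf W_closed v vP.
pose A := [set x | (x \in W) || (x \in P) && [exists (w | w \in W), e x w]].
have A_closed : closed e (mem A).
  apply: intro_closed; first exact: sym_connect_sym.
  move=> x y exy; rewrite !inE => /orP[xW|/andP[xP /exists_inP[w wW exw]]].
    have [yP|yP] := boolP (y \in P); last by rewrite (W_closed x).
    by apply/orP; right; apply/exists_inP; exists x; rewrite // e_sym.
  by rewrite (degree1_neighbor (P_leaf x xP) exy exw) wW.
have := closed_connect A_closed (conn w0 v).
by rewrite !inE w0W /= (negbTE vP) orbF => /esym.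
Qed.

Lemma star_of_degrees (c : T) :
    degree e c = #|T|.-1 -> (forall u, u != c -> degree e u = 1) -> is_star e c.
Proof.
move=> deg_c deg_u.
have Nc : [set w | e c w] = [set~ c].
  apply/eqP; rewrite eqEcard cardsC1 -deg_c leqnn andbT.
  by apply/subsetP => w; rewrite !inE; apply: contraL => /eqP ->; rewrite e_irr.
have cE w : e c w = (w != c) by move/setP/(_ w): Nc; rewrite !inE.
move=> u v; have [->|u_c] := eqVneq u c; first by rewrite cE.
have [->|v_c] := eqVneq v c; first by rewrite e_sym cE u_c.
apply/negbTE/negP => uv; case/eqP: v_c.
by apply: (degree1_neighbor (deg_u u u_c) uv); rewrite e_sym cE.
Qed.

Section Biregular.
Variables (V1 : {set T}) (d1 d2 b : nat).
Hypothesis deg1 : {in V1, forall u, degree e u = d1}.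
Hypothesis deg2 : forall v, v \notin V1 -> degree e v = d2.
Hypothesis indep : {in V1 & V1, forall u v, ~~ e u v}.
Hypothesis cross : forall v, v \notin V1 -> #|[set w in V1 | e v w]| = b.

Let n2 := #|~: V1|.

Lemma degree_split v : v \notin V1 ->
  b + #|[set w in ~: V1 | e v w]| = d2.
Proof.
move=> vV2; rewrite -(deg2 vV2) -(cross vV2) /degree -(cardsID V1 [set w | e v w]).
by congr (_ + _); apply: eq_card => w; rewrite !inE // andbC.
Qed.

Lemma inner_degree v : v \notin V1 -> #|[set w in ~: V1 | e v w]| = d2 - b.
Proof. by move=> /degree_split <-; rewrite addKn. Qed.

Lemma degree1_le u : u \in V1 -> d1 <= n2.
Proof.
move=> uV1; rewrite -(deg1 uV1); apply: subset_leq_card.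
apply/subsetP => w; rewrite !inE; apply: contraL => wV1; exact: indep.
Qed.

Lemma inner_degree_le v : v \notin V1 -> d2 - b <= n2 - 1.
Proof.
move=> vV2; rewrite -(inner_degree vV2) subn1 /n2 (cardsD1 v (~: V1)) inE vV2.
apply: subset_leq_card; apply/subsetP => w; rewrite !inE => /andP[-> ew].
by rewrite andbT; apply: contraTneq ew => ->; rewrite e_irr.
Qed.

Hypothesis conn : graph_connected e.

(** Here the vertices outside [V1] are pendant, so [u] with its neighbors is a
    whole component. *)
Lemma connected_d2_1 u : u \in V1 -> b = 1 -> d2 = 1 -> V1 = [set u].
Proof.
move=> uV1 b1 d21.
have V2_indep : {in ~: V1 & ~: V1, forall x y, ~~ e x y}.
  move=> x y; rewrite !inE => xV2 yV2; apply/negP => xy.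
  have /eqP := inner_degree xV2; rewrite b1 d21 cards_eq0 => /eqP/setP/(_ y).
  by rewrite !inE yV2 xy.
apply/eqP; rewrite eqEsubset sub1set uV1 andbT; apply/subsetP => w wV1.
apply: (connected_leaf_complement conn (set11 u) V2_indep) => [x|x y|].
- by rewrite inE => /deg2 ->.
- by rewrite !inE negbK => /eqP -> yV1; rewrite (negbTE (indep uV1 yV1)).
- by rewrite inE negbK.
Qed.

Hypothesis d1_1 : d1 = 1.

Let leaf x : x \in V1 -> degree e x = 1.
Proof. by move=> /deg1 ->. Qed.

Lemma connected_inner_degree0 v : v \notin V1 -> d2 - b = 0 -> ~: V1 = [set v].
Proof.
move=> vV2 r0; apply/eqP; rewrite eqEsubset sub1set inE vV2 andbT.
apply/subsetP => w; rewrite in_setC; move: w.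
apply: (connected_leaf_complement conn (set11 v) indep leaf) => x y /set1P -> yV2 vy.
have /eqP := inner_degree vV2; rewrite r0 cards_eq0 => /eqP/setP/(_ y).
by rewrite !inE yV2 vy.
Qed.

Lemma inner_neighbor v : v \notin V1 -> d2 - b = 1 ->
  exists w, [/\ w \notin V1, e v w & forall y, y \notin V1 -> e v y -> y = w].
Proof.
move=> vV2 r1; have /eqP := inner_degree vV2; rewrite r1 => /cards1P[w /setP Nv].
exists w; have := Nv w; rewrite !inE eqxx => /andP[wV2 vw]; split=> // y yV2 vy.
by have := Nv y; rewrite !inE yV2 vy => /esym/eqP.
Qed.

(** With the vertices of [V1] pendant, connectivity rests on the graph induced
    outside [V1]; if that graph is 1-regular it is a single edge. *)
Lemma connected_inner_degree1 v : v \notin V1 -> d2 - b = 1 ->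
  exists w, [/\ v != w, e v w & ~: V1 = [set v; w]].
Proof.
move=> vV2 r1; have [w [wV2 vw v_nbr]] := inner_neighbor vV2 r1.
have vw_neq : v != w by apply: contraTneq vw => <-; rewrite e_irr.
exists w; split=> //; apply/eqP; rewrite eqEsubset; apply/andP; split; last first.
  by apply/subsetP => x /set2P[] ->; rewrite inE.
apply/subsetP => z; rewrite in_setC; move: z.
apply: (connected_leaf_complement conn (set21 v w) indep leaf) => x y.
case/set2P=> -> yV2; first by move/(v_nbr y yV2) ->; apply: set22.
have [w' [_ _ w_nbr]] := inner_neighbor wV2 r1.
by move/(w_nbr y yV2) ->; rewrite -(w_nbr v vV2) ?set21 // e_sym.
Qed.

Lemma double_star_shape v w : v != w -> e v w -> ~: V1 = [set v; w] -> 0 < b ->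
  is_double_star e v w.
Proof.
move=> vw_neq vw V2E b_gt0.
have inV1 u : u != v -> u != w -> u \in V1.
  move=> uv uw; apply: contraTT (isT) => uV2.
  by move/setP/(_ u): V2E; rewrite !inE uV2 (negbTE uv) (negbTE uw).
have V2 u : u \in [set v; w] -> u \notin V1 by rewrite -V2E inE.
have leafE c u : u \in V1 -> e u c -> leaf_of e c u.
  move=> uV1 uc x; apply/idP/eqP => [ux|-> //].
  exact: degree1_neighbor (leaf uV1) ux uc.
have has_leaf c : c \in [set v; w] -> exists u, [/\ u != v, u != w & leaf_of e c u].
  move=> /V2 cV2; have : 0 < #|[set w in V1 | e c w]| by rewrite cross.
  case/card_gt0P=> u; rewrite inE => /andP[uV1 cu]; exists u; split.
  - by apply: contraTneq uV1 => ->; apply: V2; apply: set21.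
  - by apply: contraTneq uV1 => ->; apply: V2; apply: set22.
  - by apply: leafE => //; rewrite e_sym.
split=> //; [|exact: has_leaf (set21 v w)|exact: has_leaf (set22 v w)].
move=> u uv uw; have uV1 := inV1 u uv uw.
have : 0 < degree e u by rewrite leaf.
case/card_gt0P=> x; rewrite inE => ux.
have : x \in ~: V1.
  by rewrite inE; apply: contraL ux => xV1; apply: indep.
rewrite V2E => /set2P[] xE; [left|right]; apply: leafE => //; by rewrite -xE.
Qed.

End Biregular.
End Graphs.

Lemma degree_induced (T : finType) (e : rel T) (A : {set T})
  (v : {x : T | x \in A}) :
  degree (induced e A) v = #|[set w in A | e (val v) w]|.
Proof.
rewrite /degree -(card_imset _ val_inj); apply: eq_card => w.
apply/imsetP/idP => [[x]|]; rewrite !inE.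
  by move=> vx ->; rewrite (valP x).
by case/andP=> wA vw; exists (Sub w wA); rewrite // inE.
Qed.

Lemma connected_degree_gt0 (T : finType) (e : rel T) (v : T) :
  1 < #|T| -> graph_connected e -> 0 < degree e v.
Proof.
rewrite -cardsT (cardsD1 v) inE ltnS => /card_gt0P[w]; rewrite !inE => /andP[wv _] conn.
have /connectP[[|x p] /= vp wE] := conn v w; first by rewrite wE eqxx in wv.
by apply/card_gt0P; exists x; rewrite inE; case/andP: vp.
Qed.

Section ExtremalGraphs.
Variables (d1 n1 d2 n2 : nat).
Hypotheses (n1_gt0 : 0 < n1) (n2_gt0 : 0 < n2) (d1_gt0 : 0 < d1).
Hypotheses (d1_neq_d2 : d1 <> d2) (le_n1d1_n2d2 : n1 * d1 <= n2 * d2).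

(** [extremal_pattern] for an adjacency matrix, in terms of cardinals. *)
Definition extremal_graph (e : rel 'I_(n1 + n2)) : Prop :=
  let V1 := degree_class e d1 in
  {in V1 & V1, forall u v, ~~ e u v} /\
  (forall v, v \notin V1 -> n2 * #|[set w in V1 | e v w]| = n1 * d1).

Section OneGraph.
Variable e : rel 'I_(n1 + n2).
Hypothesis e_degrees : two_degrees d1 d2 e.
Let V1 := degree_class e d1.

Lemma two_degreesE v : (v \in degree_class e d2) = (v \notin V1).
Proof.
case: e_degrees => _ c1 c2; rewrite !inE; apply: two_valued_by_count; last first.
  by rewrite card_ord; congr (_ + _).
exact/eqP.
Qed.

Section Radius.
Import Order.TTheory GRing.Theory Num.Theory.
Local Open Scope ring_scope.
Variable R : realType.

Let M := adjacency_mx R e.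

Let M_sum (A : {set 'I_(n1 + n2)}) i :
  \sum_(j in A) M i j = #|[set w in A | e i w]|%:R.
Proof.
rewrite -sum1_card natr_sum [LHS]big_mkcond [RHS]big_mkcond.
by apply: eq_bigr => j _; rewrite inE mxE; case: (j \in A) => //=; case: (e i j).
Qed.

Let M_row i : \sum_j M i j = (degree e i)%:R.
Proof.
transitivity (\sum_(j in [set: 'I_(n1 + n2)]) M i j); first by apply: eq_bigl => j; rewrite inE.
by rewrite M_sum; congr (_%:R); apply: eq_card => j; rewrite !inE.
Qed.

Let M_class d : row_class M d = degree_class e d.
Proof. by apply/setP => i; rewrite !inE M_row eqr_nat. Qed.

Lemma adjacency_two_row_sums : two_row_sums d1 d2 M.
Proof.
case: e_degrees => -[e_sym _] c1 c2; split.
- by apply/matrixP => i j; rewrite !mxE e_sym.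
- by move=> i j; rewrite mxE ler0n.
- by rewrite -[RHS]c1 -M_class.
- by rewrite -[RHS]c2 -M_class.
Qed.

(** The adjacency matrix competes for the minimum, and it reaches it exactly in the
    equality case of the lower bound. *)
Lemma graph_spectral_radius_minP :
  graph_spectral_radius R e = min_spectral_radius R d1 n1 d2 n2
  <-> extremal_graph e.
Proof.
have [lam [lam_gt0 lam_d1 lamE]] :=
  @extremal_root R d1 n1 d2 n2 n1_gt0 n2_gt0 d1_gt0 d1_neq_d2 le_n1d1_n2d2.
rewrite (min_spectral_radius_root n1_gt0 n2_gt0 d1_gt0 d1_neq_d2 le_n1d1_n2d2
  lam_gt0 lam_d1 lamE).
rewrite (spectral_radius_eq_rootP n1_gt0 n2_gt0 d1_gt0 d1_neq_d2
  lam_gt0 lam_d1 lamE adjacency_two_row_sums).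
rewrite /extremal_pattern /extremal_graph M_class.
split=> -[indep cross]; split.
- move=> u v uV1 vV1; have /eqP := indep u v uV1 vV1.
  by rewrite mxE pnatr_eq0 eqb0.
- move=> v /cross /eqP; rewrite M_sum -!natrM eqr_nat => /eqP //.
- by move=> u v uV1 vV1; rewrite mxE (negbTE (indep u v uV1 vV1)).
- by move=> v /cross vE; rewrite M_sum -!natrM vE.
Qed.
End Radius.

Hypothesis e_extremal : extremal_graph e.
Hypothesis e_conn : graph_connected e.

Let e_simple : simple_graph e. Proof. by case: e_degrees. Qed.
Let b := n1 * d1 %/ n2.

Let cardV1 : #|V1| = n1. Proof. by case: e_degrees. Qed.
Let cardV2 : #|~: V1| = n2.
Proof. by rewrite cardsCs setCK card_ord cardV1 addKn. Qed.

Let deg1 : {in V1, forall u, degree e u = d1}.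
Proof. by move=> u; rewrite inE => /eqP. Qed.
Let deg2 v : v \notin V1 -> degree e v = d2.
Proof. by rewrite -two_degreesE inE => /eqP. Qed.
Let indep : {in V1 & V1, forall u v, ~~ e u v}.
Proof. by case: e_extremal. Qed.

Let exV1 : exists u, u \in V1.
Proof. by apply/card_gt0P; rewrite cardV1. Qed.
Let exV2 : exists v, v \notin V1.
Proof.
have /card_gt0P[v] : 0 < #|~: V1| by rewrite cardV2.
by rewrite inE; exists v.
Qed.

Let cross v : v \notin V1 -> #|[set w in V1 | e v w]| = b.
Proof.
by case: e_extremal => _ eq /eq vE; rewrite /b -vE mulKn.
Qed.

Let n2b : n2 * b = n1 * d1.
Proof.
have [v vV2] := exV2; rewrite -(cross vV2); case: e_extremal => _; exact.
Qed.

Let b_gt0 : 0 < b.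
Proof. by move: n2b; case: b => //; rewrite muln0 => /esym/eqP; rewrite muln_eq0; lia. Qed.

Let le_b_d2 : b <= d2.
Proof. by rewrite -(leq_pmul2l n2_gt0) n2b. Qed.

Lemma extremal_feasible : feasible d1 n1 d2 n2.
Proof.
have [u uV1] := exV1; have [v vV2] := exV2; split.
- have := even_sum_degree e_simple; rewrite (bigID (mem V1)) /=.
  rewrite (eq_bigr _ deg1) sum_nat_const cardV1.
  rewrite (eq_bigr (fun=> d2)) => [|w /deg2 //].
  have cardV2' : #|[set w | w \notin V1]| = n2.
    by rewrite -[RHS]cardV2; apply: eq_card => w; rewrite !inE.
  by rewrite sum_nat_cond_const cardV2' addnC.
- by rewrite -n2b dvdn_mulr.
- by have := degree1_le deg1 indep uV1; rewrite cardV2.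
- rewrite -n2b -mulnBr leq_pmul2l //.
  by have := inner_degree_le e_simple deg2 cross vV2; rewrite cardV2.
Qed.

(** When [d1] or [d2] is 1 that class consists of leaves, and connectivity forces
    the rest: for [d2 = 1] a single center, for [d1 = 1] the inner graph on the
    other class is connected of constant degree [d2 - b], which gives a point, an
    edge, or degree at least two. *)
Lemma extremal_connected_case :
  case_a d1 d2 \/ case_b d1 n1 d2 n2 \/ case_c d1 n1 d2 n2 \/
  case_d d1 n1 d2 n2 \/ case_e d1 n1 d2 n2.
Proof.
have [u uV1] := exV1; have [v vV2] := exV2.
have [d1_ge2|d1_lt2] := leqP 2 d1.
  have [d2_ge2|d2_lt2] := leqP 2 d2; first by left.
  have d21 : d2 = 1 by lia.
  have b1 : b = 1 by lia.
  have V1E := connected_d2_1 e_simple deg2 indep cross e_conn uV1 b1 d21.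
  have n11 : n1 = 1 by rewrite -cardV1 V1E cards1.
  by right; left; split=> //; move: n2b; rewrite b1 n11 muln1 mul1n.
have d11 : d1 = 1 by lia.
have n1E : n1 = n2 * b by rewrite n2b d11 muln1.
have d2_gt1 : 1 < d2 by lia.
do 2!right; case r: (d2 - b) => [|[|k]].
- have V2E := connected_inner_degree0 e_simple deg1 deg2 indep cross e_conn d11 vV2 r.
  have n21 : n2 = 1 by rewrite -cardV2 V2E cards1.
  by left; split=> //; rewrite n1E n21; lia.
- have [w [vw _ V2E]] :=
    connected_inner_degree1 e_simple deg1 deg2 indep cross e_conn d11 vV2 r.
  have n22 : n2 = 2 by rewrite -cardV2 V2E cards2 vw.
  by right; left; split=> //; rewrite n1E n22; lia.
- by right; right; split=> //; rewrite -n2b -mulnBr r mulnC leq_mul2l orbT.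
Qed.

Lemma extremal_shape :
  [/\ case_b d1 n1 d2 n2 ->
        (exists2 c, c \in degree_class e d1 & is_star e c),
      case_c d1 n1 d2 n2 ->
        (exists2 c, c \in degree_class e d2 & is_star e c),
      case_d d1 n1 d2 n2 ->
        (exists c1 c2, [/\ c1 \in degree_class e d2,
                           c2 \in degree_class e d2
                         & is_double_star e c1 c2])
    & case_e d1 n1 d2 n2 ->
        [/\ exists2 r, 2 <= r & regular (induced e (degree_class e d2)) r,
            n2 %| n1
          & forall v, v \in degree_class e d2 ->
              #|[set w in degree_class e d1 | e v w]| = n1 %/ n2]].
Proof.
have [u uV1] := exV1; have [v vV2] := exV2.
have V2E : degree_class e d2 = ~: V1.
  by apply/setP => w; rewrite two_degreesE in_setC.
split.
- case=> n11 d21 n2E _; exists u => //; apply: star_of_degrees => // [|w wu].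
    by rewrite deg1 // card_ord n11.
  have /eqP/cards1P[x V1E] : #|V1| = 1 := etrans cardV1 n11.
  by rewrite deg2 //; move: uV1 wu; rewrite V1E !in_set1 => /eqP ->.
- case=> n21 d11 n1E _; exists v; first by rewrite two_degreesE.
  apply: star_of_degrees => // [|w wv]; first by rewrite deg2 // card_ord n21 addn1.
  have /eqP/cards1P[x /setP V2x] : #|~: V1| = 1 := etrans cardV2 n21.
  have := V2x v; have := V2x w; rewrite !in_setC !in_set1 vV2 => wE /esym/eqP vx.
  by rewrite deg1 //; apply/negPn; rewrite wE -vx.
- case=> d11 n22 d2_gt1 n1E.
  have bE : b = d2 - 1.
    by apply/eqP; rewrite -(eqn_pmul2l n2_gt0) n2b n22 d11 muln1 n1E.
  have r1 : d2 - b = 1 by lia.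
  have [w [vw evw VE]] :=
    connected_inner_degree1 e_simple deg1 deg2 indep cross e_conn d11 vV2 r1.
  exists v, w; split; rewrite ?V2E ?VE ?set21 ?set22 //.
  exact: (double_star_shape e_simple deg1 indep cross d11 vw evw VE b_gt0).
- case=> d11 d2_gt1 r_ge2.
  have bE : b = n1 %/ n2 by rewrite /b d11 muln1.
  split; last 1 first.
  + by move=> w; rewrite two_degreesE => wV2; rewrite -bE cross.
  + exists (d2 - b).
      by rewrite -(leq_pmul2l n2_gt0) mulnC mulnBr n2b.
    move=> w; have wV2 : val w \notin V1 by rewrite -two_degreesE (valP w).
    rewrite degree_induced -(inner_degree deg2 cross wV2).
    by apply: eq_card => x; rewrite 2!inE two_degreesE in_setC.
  + by rewrite -[n1]muln1 -d11 -n2b dvdn_mulr.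
Qed.
End OneGraph.
End ExtremalGraphs.

(** * Construction of connected graphs attaining the minimum *)

Section Circulant.
Variable n : nat.
Notation m := n.+1.

Lemma card_ord_interval a b : a <= b <= m -> #|[set x : 'I_m | a <= x < b]| = b - a.
Proof.
have card_lt k : k <= m -> #|[set x : 'I_m | x < k]| = k.
  move=> le_km; rewrite -sum1dep_card -(big_ord_widen m (fun=> 1)) //.
  by rewrite sum1_card card_ord.
case/andP=> le_ab le_bm; rewrite -{2}(card_lt b) // -{2}(card_lt a) ?(leq_trans le_ab) //.
have -> : [set x : 'I_m | a <= x < b] = [set x : 'I_m | x < b] :\: [set x : 'I_m | x < a].
  by apply/setP => x; rewrite !inE -leqNgt.
rewrite cardsD; congr (_ - #|(_ : {set _})|); apply/setP => x; rewrite !inE.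
by case: (ltnP x a) => [xa|_]; rewrite ?andbF // andbT (leq_trans xa).
Qed.

(** The connection set of an [r]-regular circulant graph: the [r./2] smallest
    residues, their opposites and, for odd [r], the involution [m / 2]. *)
Definition circulant_set (r : nat) : {set 'I_m} :=
  [set x : 'I_m | 1 <= x < r./2.+1] :|: [set x : 'I_m | m - r./2 <= x < m]
  :|: (if odd r then [set x : 'I_m | x.*2 == m] else set0).

Lemma circulant_setE r x : (x \in circulant_set r) =
  [|| (0 < x) && (x <= r./2), m - r./2 <= x | odd r && (x.*2 == m)].
Proof. by rewrite !inE ltn_ord andbT -orbA; case: (odd r); rewrite !inE. Qed.

Lemma card_circulant_set r : r <= n -> ~~ odd (m * r) -> #|circulant_set r| = r.
Proof.
move=> le_rn even_mr.
have rE := odd_double_half r.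
have disj : [set x : 'I_m | 1 <= x < r./2.+1] :&: [set x : 'I_m | m - r./2 <= x < m] = set0.
  by apply/setP => x; rewrite !inE; apply/negbTE; lia.
have cardU : #|[set x : 'I_m | 1 <= x < r./2.+1] :|: [set x : 'I_m | m - r./2 <= x < m]|
           = r./2.*2.
  by rewrite cardsU disj cards0 !card_ord_interval; lia.
rewrite /circulant_set cardsU cardU.
case r_odd : (odd r) rE => rE; last by rewrite setI0 !cards0; lia.
have m_even : ~~ odd m by move: even_mr; rewrite oddM r_odd andbT.
have mE := odd_double_half m; rewrite (negbTE m_even) add0n in mE.
have half_lt : m./2 < m by lia.
have -> : [set x : 'I_m | x.*2 == m] = [set Ordinal half_lt].
  by apply/setP => x; rewrite !inE -val_eqE /=; apply/eqP/eqP; lia.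
rewrite cards1; set I := _ :&: _.
have -> : I = set0.
  apply/setP => x; rewrite !inE; apply/negbTE/negP => /andP[xS /eqP xE].
  by move: xS; rewrite xE /=; lia.
by rewrite cards0; lia.
Qed.

Definition circulant (r : nat) : rel 'I_m :=
  fun x y => (y - x)%R \in circulant_set r.

Lemma circulant_irr r : r <= n -> irreflexive (circulant r).
Proof.
move=> le_rn x; rewrite /circulant GRing.subrr circulant_setE /=.
have rE := odd_double_half r; apply/negbTE; case: (odd r) rE => /=; lia.
Qed.

Lemma circulant_set_oppr r (x : 'I_m) :
  x \in circulant_set r -> (- x)%R \in circulant_set r.
Proof.
rewrite !circulant_setE /=.
have [->|x_neq0] := eqVneq (x : nat) 0; first by case: (odd r) => /=; lia.
have lt_xm := ltn_ord x; rewrite modn_small; last by lia.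
by case: (odd r) => /=; lia.
Qed.

Lemma circulant_sym r : symmetric (circulant r).
Proof.
move=> x y; rewrite /circulant.
by apply/idP/idP => /circulant_set_oppr; rewrite GRing.opprB.
Qed.

Lemma circulant_degree r x : r <= n -> ~~ odd (m * r) ->
  #|[set y | circulant r x y]| = r.
Proof.
move=> le_rn even_mr; rewrite -[RHS](card_circulant_set le_rn even_mr).
rewrite -[in RHS](card_imset _ (@GRing.addIr _ x)); apply: eq_card => y; rewrite [LHS]inE.
apply/idP/imsetP => [xy|[z zS ->]]; last by rewrite /circulant GRing.addrK.
by exists (y - x)%R; rewrite ?GRing.subrK.
Qed.

(** The residue 1 is one of the small residues as soon as [r >= 2]; on two vertices
    it is the involution.  So the circulant then contains a Hamiltonian path. *)
Lemma circulant_succ r (x y : 'I_m) : (2 <= r) || (m <= r.+1) ->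
  y = x.+1 :> nat -> circulant r x y.
Proof.
move=> r_big yE; have lt_ym := ltn_ord y.
have sub1 : (y - x)%R = 1 :> nat.
  rewrite /= yE modnDmr; have -> : x.+1 + (m - x) = m + 1 by lia.
  by rewrite modnDl modn_small //; lia.
rewrite /circulant circulant_setE sub1.
case/orP: r_big => [r_ge2|le_mr]; first by have := half_leq r_ge2; lia.
have rE := odd_double_half r.
case r_odd : (odd r) rE => rE /=; lia.
Qed.
End Circulant.

Section Slots.
Variables c m : nat.
Hypotheses (c_gt0 : 0 < c) (m_gt0 : 0 < m).

(** Half-edges are numbered by [p]; consecutive blocks of [c] belong to one vertex
    on the left, and [slot p] is the vertex on the right.  Reading [p] modulo [m]
    runs through the right side once per lap.  When [c] divides [m] every lap would
    be cut into the same blocks, which gives disjoint complete bipartite pieces,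
    so all laps after the first are rotated by one. *)
Definition slot p := (p + ((c %| m) && (m <= p))) %% m.

(** The half-edge at which lap [k] visits [j]. *)
Definition slot_inv k j := k * m + (j + (m - 1) * ((c %| m) && (0 < k))) %% m.

Lemma slot_lt p : slot p < m. Proof. by rewrite ltn_mod. Qed.

Lemma slot_inv_div k j : slot_inv k j %/ m = k.
Proof. by rewrite /slot_inv divnMDl // divn_small ?addn0 // ltn_mod. Qed.

Let shift_cancel i (s : bool) : i + (m - 1) * s + s = s * m + i.
Proof. by case: s; lia. Qed.

Lemma slot_invK k j : j < m -> slot (slot_inv k j) = j.
Proof.
move=> lt_jm; have kE := slot_inv_div k j.
rewrite /slot -divn_gt0 // kE /slot_inv -addnA modnMDl modnDml shift_cancel.
by rewrite modnMDl modn_small.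
Qed.

Lemma slotK p : slot_inv (p %/ m) (slot p) = p.
Proof.
rewrite [RHS](divn_eq p m) /slot_inv; congr (_ + _).
rewrite /slot -(divn_gt0 _ m_gt0) modnDml -addnA [_ + (_ - _) * _]addnC addnA.
by rewrite shift_cancel modnMDl.
Qed.

Lemma slot_inv_lt L k j : k < L -> slot_inv k j < m * L.
Proof.
move=> lt_kL; rewrite mulnC -ltn_divLR // slot_inv_div //.
Qed.

(** A block has at most [m] elements, and it is rotated as a whole or not at all
    because the rotation starts at a multiple of [c]. *)
Lemma slot_inj p p' : c <= m -> p %/ c = p' %/ c -> slot p = slot p' -> p = p'.
Proof.
move=> le_cm.
wlog le_pp' : p p' / p <= p' => [sym pp'c pp'|pp'c].
  by have [/sym|/ltnW/sym] := leqP p p'; [apply|move=> s; apply/esym/s].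
have sE : (c %| m) && (m <= p) = (c %| m) && (m <= p').
  have [/dvdnP[q ->]|//] := boolP (c %| m).
  by rewrite /= -!leq_divRL // pp'c.
rewrite /slot sE => /eqP; rewrite eqn_modDr eq_sym eqn_mod_dvd // => dvd.
have : p' - p < m.
  apply: leq_trans le_cm; rewrite (divn_eq p c) (divn_eq p' c) pp'c.
  have := ltn_pmod p' c_gt0; lia.
move=> lt_m; apply/eqP; rewrite eqn_leq le_pp' -subn_eq0.
by apply: contraTT dvd; rewrite -lt0n => /gtnNdvd ->.
Qed.

(** Two neighbors [j], [j + 1] are in a common block in lap 0 unless a block ends
    between them, that is [c] divides [j + 1].  Then lap 1 joins them: its block
    boundaries are displaced relative to those of lap 0, by [m] modulo [c] or, if
    this is 0, by the rotation. *)
Lemma slot_chain L j : 1 < c -> 1 < L -> j.+1 < m ->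
  exists p p', [/\ p < m * L, p' < m * L, p %/ c = p' %/ c, slot p = j & slot p' = j.+1].
Proof.
move=> c_gt1 L_gt1 lt_jm.
have m2L : m * 2 <= m * L by rewrite leq_pmul2l.
have succ_div p : ~~ (c %| p.+1) -> p %/ c = p.+1 %/ c.
  by move=> ndvd; rewrite divnS // (negbTE ndvd).
have [dvd_cj|ndvd_cj] := boolP (c %| j.+1); last first.
  exists j, j.+1; split; rewrite /slot ?[m <= _]leqNgt; try lia.
  - exact: succ_div.
  - by rewrite (ltnW lt_jm) andbF addn0 modn_small // ltnW.
  - by rewrite lt_jm andbF addn0 modn_small.
have [dvd_cm|ndvd_cm] := boolP (c %| m); last first.
  exists (m + j), (m + j).+1; split; rewrite /slot; try lia.
  - by apply: succ_div; rewrite -addnS dvdn_addl.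
  - by rewrite (negbTE ndvd_cm) addn0 modnDl modn_small // ltnW.
  - by rewrite (negbTE ndvd_cm) addn0 -addnS modnDl modn_small.
have j_gt0 : 0 < j by case: j dvd_cj {lt_jm} => //; rewrite dvdn1; lia.
exists (m + j).-1, (m + j); split; rewrite /slot; try lia.
- have mjE : m + j = (m + j).-1.+1 by lia.
  rewrite {2}mjE; apply: succ_div; rewrite -mjE dvdn_addr //.
  apply/negP => dvd_j; have : c %| 1 by rewrite -(dvdn_addr _ dvd_j) addn1.
  by rewrite dvdn1; lia.
- rewrite dvd_cm; have -> : m <= (m + j).-1 by lia.
  have -> : (m + j).-1 + (true && true) = m + j by rewrite /=; lia.
  by rewrite modnDl modn_small // ltnW.
- by rewrite dvd_cm leq_addr /= -addnA modnDl addn1 modn_small.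
Qed.
End Slots.

Lemma chain_connect (T : finType) (e : rel T) (m : nat) (v : 'I_m -> T) :
    connect_sym e ->
    (forall j k : 'I_m, k = j.+1 :> nat -> connect e (v j) (v k)) ->
  forall j k, connect e (v j) (v k).
Proof.
move=> e_sym step.
have up d (j k : 'I_m) : k = j + d :> nat -> connect e (v j) (v k).
  elim: d k => [|d IHd] k kE; first by have -> : k = j by apply: val_inj => /=; lia.
  have lt_m : j + d < m by have := ltn_ord k; lia.
  apply: connect_trans (IHd (Ordinal lt_m) erefl) (step _ _ _) => /=; lia.
move=> j k; have [le_jk|/ltnW le_kj] := leqP j k.
  by apply: (up (k - j)); lia.
by rewrite e_sym; apply: (up (j - k)); lia.
Qed.

Lemma connected_from_hubs (T I : finType) (e : rel T) (hub : I -> T) :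
    connect_sym e -> (forall i j, connect e (hub i) (hub j)) ->
    (forall u, exists i, connect e u (hub i)) ->
  graph_connected e.
Proof.
move=> e_sym hubs to_hub u v.
have [i ui] := to_hub u; have [j vj] := to_hub v.
apply: connect_trans ui (connect_trans (hubs i j) _).
by rewrite e_sym.
Qed.

(** [bip] gives the edges between the two classes and [h] those inside the second;
    the first class, embedded by [lshift], is independent. *)
Section Glue.
Variables (n1 n2 : nat) (bip : 'I_n1 -> 'I_n2 -> bool) (h : rel 'I_n2).
Hypotheses (h_sym : symmetric h) (h_irr : irreflexive h).

Definition glue : rel 'I_(n1 + n2) := fun u v =>
  match split u, split v with
  | inl _, inl _ => false
  | inl i, inr j => bip i j
  | inr j, inl i => bip i j
  | inr j, inr k => h j k
  end.

Let split_l (i : 'I_n1) : split (lshift n2 i) = inl i :> 'I_n1 + 'I_n2.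
Proof. exact: unsplitK (inl i). Qed.
Let split_r (j : 'I_n2) : split (rshift n1 j) = inr j :> 'I_n1 + 'I_n2.
Proof. exact: unsplitK (inr j). Qed.

Lemma glue_ll i i' : glue (lshift n2 i) (lshift n2 i') = false.
Proof. by rewrite /glue !split_l. Qed.
Lemma glue_lr i j : glue (lshift n2 i) (rshift n1 j) = bip i j.
Proof. by rewrite /glue split_l split_r. Qed.
Lemma glue_rl i j : glue (rshift n1 j) (lshift n2 i) = bip i j.
Proof. by rewrite /glue split_l split_r. Qed.
Lemma glue_rr j k : glue (rshift n1 j) (rshift n1 k) = h j k.
Proof. by rewrite /glue !split_r. Qed.

Lemma glue_simple : simple_graph glue.
Proof.
split=> [u v|u]; rewrite /glue; last by case: (split u).
by case: (split u); case: (split v).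
Qed.

Lemma glue_connect_sym : connect_sym glue.
Proof. by apply: sym_connect_sym; case: glue_simple. Qed.

Variables d1 d2 b r : nat.
Hypothesis d1_neq_d2 : d1 <> d2.
Hypothesis bip_l : forall i, #|[set j | bip i j]| = d1.
Hypothesis bip_r : forall j, #|[set i | bip i j]| = b.
Hypothesis h_r : forall j, #|[set k | h j k]| = r.
Hypothesis brE : b + r = d2.
Hypothesis n2b : n2 * b = n1 * d1.

Let deg_l i : degree glue (lshift n2 i) = d1.
Proof.
rewrite /degree card_set_split -[RHS](bip_l i) -[RHS]add0n; congr (_ + _).
  by apply: eq_card0 => k; rewrite inE glue_ll.
by apply: eq_card => k; rewrite !inE glue_lr.
Qed.

Let deg_r j : degree glue (rshift n1 j) = d2.
Proof.
rewrite /degree card_set_split -brE -[in RHS](bip_r j) -(h_r j); congr (_ + _).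
  by apply: eq_card => k; rewrite !inE glue_rl.
by apply: eq_card => k; rewrite !inE glue_rr.
Qed.

Let d12 : (d1 == d2) = false. Proof. exact/eqP. Qed.

Lemma glue_two_degrees : two_degrees d1 d2 glue.
Proof.
split; first exact: glue_simple.
  rewrite card_set_split -[RHS]addn0 -[in RHS](card_ord n1) -[in RHS]cardsT.
  congr (_ + _); first by apply: eq_card => i; rewrite !inE deg_l eqxx.
  by apply: eq_card0 => j; rewrite inE deg_r eq_sym d12.
rewrite card_set_split -[RHS]add0n -[in RHS](card_ord n2) -[in RHS]cardsT.
congr (_ + _); first by apply: eq_card0 => i; rewrite inE deg_l d12.
by apply: eq_card => j; rewrite !inE deg_r eqxx.
Qed.

Lemma glue_extremal : extremal_graph d1 glue.
Proof.
split=> [u v|v]; rewrite !inE.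
  case: (split_ordP u) => i ->; last by rewrite deg_r eq_sym d12.
  case: (split_ordP v) => j ->; last by rewrite deg_r [d2 == _]eq_sym d12.
  by rewrite glue_ll.
case: (split_ordP v) => j ->; first by rewrite deg_l eqxx.
move=> _; rewrite -n2b; congr (_ * _).
rewrite card_set_split -(bip_r j) -[RHS]addn0; congr (_ + _).
  by apply: eq_card => i; rewrite !inE deg_l eqxx glue_rl.
by apply: eq_card0 => k; rewrite !inE deg_r eq_sym d12.
Qed.

Hypotheses (d1_gt0 : 0 < d1) (b_gt0 : 0 < b).

Lemma glue_nbr_l i : exists j, bip i j.
Proof.
have : 0 < #|[set j | bip i j]| by rewrite bip_l.
by case/card_gt0P=> j; rewrite inE; exists j.
Qed.

Lemma glue_nbr_r j : exists i, bip i j.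
Proof.
have : 0 < #|[set i | bip i j]| by rewrite bip_r.
by case/card_gt0P=> i; rewrite inE; exists i.
Qed.

Lemma glue_connected_r :
  (forall j k : 'I_n2, k = j.+1 :> nat ->
     connect glue (rshift n1 j) (rshift n1 k)) -> graph_connected glue.
Proof.
move=> step; apply: (connected_from_hubs (hub := @rshift n1 n2) glue_connect_sym).
  exact: chain_connect glue_connect_sym step.
move=> u; case: (split_ordP u) => [i ->|j ->]; last by exists j.
by have [j ij] := glue_nbr_l i; exists j; apply: connect1; rewrite glue_lr.
Qed.

Lemma glue_connected_l :
  (forall i k : 'I_n1, k = i.+1 :> nat ->
     connect glue (lshift n2 i) (lshift n2 k)) -> graph_connected glue.
Proof.
move=> step; apply: (connected_from_hubs (hub := @lshift n1 n2) glue_connect_sym).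
  exact: chain_connect glue_connect_sym step.
move=> u; case: (split_ordP u) => [i ->|j ->]; first by exists i.
by have [i ij] := glue_nbr_r j; exists i; apply: connect1; rewrite glue_rl.
Qed.
End Glue.

Section SlotGraph.
Variables (n1 n2 d1 b : nat).
Hypotheses (n2_gt0 : 0 < n2) (d1_gt0 : 0 < d1) (le_d1_n2 : d1 <= n2).
Hypothesis n2b : n2 * b = n1 * d1.

Definition slot_bip (i : 'I_n1) (j : 'I_n2) : bool :=
  [exists t : 'I_d1, slot d1 n2 (i * d1 + t) == j].

Lemma slot_bipP (i : 'I_n1) (j : 'I_n2) :
  reflect (exists p, [/\ p < n2 * b, p %/ d1 = i & slot d1 n2 p = j]) (slot_bip i j).
Proof.
apply: (iffP existsP) => [[t /eqP tE]|[p [_ pi pj]]].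
  have iE : (i * d1 + t) %/ d1 = i by rewrite divnMDl // divn_small ?addn0.
  exists (i * d1 + t); split=> //.
  by rewrite n2b -ltn_divLR // iE.
exists (Ordinal (ltn_pmod p d1_gt0)); apply/eqP.
by rewrite /= -pi -divn_eq.
Qed.

Lemma slot_bip_l i : #|[set j | slot_bip i j]| = d1.
Proof.
pose f (t : 'I_d1) : 'I_n2 := Ordinal (slot_lt d1 n2_gt0 (i * d1 + t)).
have f_inj : injective f.
  move=> t t' /(congr1 val) /= ft; apply: val_inj => /=.
  apply/eqP; rewrite -(eqn_add2l (i * d1)); apply/eqP.
  apply: (slot_inj d1_gt0 n2_gt0 le_d1_n2) ft.
  by rewrite !divnMDl // !divn_small.
rewrite -[RHS](card_ord d1) -cardsT -(card_imset _ f_inj).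
apply: eq_card => j; rewrite inE; apply/existsP/imsetP => [[t /eqP tE]|[t _ ->]].
  by exists t => //; apply: val_inj.
by exists t.
Qed.

Lemma slot_bip_r j : #|[set i | slot_bip i j]| = b.
Proof.
have lt_n1 (k : 'I_b) : slot_inv d1 n2 k j %/ d1 < n1.
  by rewrite ltn_divLR // -n2b slot_inv_lt.
pose f (k : 'I_b) : 'I_n1 := Ordinal (lt_n1 k).
have f_inj : injective f.
  move=> k k' /(congr1 val) /= fk; apply: val_inj => /=.
  rewrite -(slot_inv_div d1 n2_gt0 k j) -(slot_inv_div d1 n2_gt0 k' j).
  congr (_ %/ _); apply: (slot_inj d1_gt0 n2_gt0 le_d1_n2 fk).
  by rewrite !slot_invK.
rewrite -[RHS](card_ord b) -cardsT -(card_imset _ f_inj).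
apply: eq_card => i; rewrite inE; apply/slot_bipP/imsetP => [[p [lt_p pi pj]]|[k _ ->]].
  have lt_b : p %/ n2 < b by rewrite ltn_divLR // mulnC.
  by exists (Ordinal lt_b) => //; apply: val_inj; rewrite /= -pj slotK.
exists (slot_inv d1 n2 k j); split=> //; first exact: slot_inv_lt.
exact: slot_invK.
Qed.
End SlotGraph.

Section Construction.
Variables (d1 n1 d2 n2 : nat).
Hypotheses (n1_gt0 : 0 < n1) (n2_gt0 : 0 < n2) (d1_gt0 : 0 < d1).
Hypotheses (d1_neq_d2 : d1 <> d2) (le_n1d1_n2d2 : n1 * d1 <= n2 * d2).
Hypothesis feas : feasible d1 n1 d2 n2.

Let b := n1 * d1 %/ n2.
Let r := d2 - b.

Let n2b : n2 * b = n1 * d1.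
Proof. by case: feas => _ dvd _ _; rewrite mulnC divnK. Qed.

Let b_gt0 : 0 < b.
Proof. by rewrite -(ltn_pmul2l n2_gt0) n2b muln0 muln_gt0 n1_gt0. Qed.

Let brE : b + r = d2.
Proof. by rewrite subnKC // -(leq_pmul2l n2_gt0) n2b. Qed.

Let n2r : n2 * d2 - n1 * d1 = n2 * r.
Proof. by rewrite -n2b -mulnBr. Qed.

Let r_le : r <= n2 - 1.
Proof. by case: feas => _ _ _; rewrite n2r leq_pmul2l. Qed.

Let n2r_even : ~~ odd (n2 * r).
Proof. by rewrite -n2r oddB // addbC -oddD addnC; case: feas. Qed.

Let le_d1_n2 : d1 <= n2. Proof. by case: feas. Qed.

(** Slots between the classes and a circulant inside the second one.  It is
    connected because of the circulant in the first two cases and because of the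
    slots in the third; a single vertex in the first class is joined to all
    others. *)
Lemma extremal_slot_graph :
  [\/ 2 <= r, n2 <= r.+1, 2 <= b /\ 2 <= d1 | n1 = 1] ->
  exists e : rel 'I_(n1 + n2),
    [/\ two_degrees d1 d2 e, graph_connected e & extremal_graph d1 e].
Proof.
have [n n2E] : exists n, n2 = n.+1 by exists n2.-1; rewrite prednK.
have [h [h_sym h_irr h_r h_succ]] : exists h : rel 'I_n2,
    [/\ symmetric h, irreflexive h, (forall j, #|[set k | h j k]| = r)
      & (2 <= r) || (n2 <= r.+1) -> forall j k : 'I_n2, k = j.+1 :> nat -> h j k].
  move: r_le n2r_even; rewrite n2E subn1 /= => le_rn even_r.
  exists (@circulant n r); split.
  - exact: circulant_sym.
  - exact: circulant_irr.
  - by move=> j; apply: circulant_degree.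
  - by move=> big j k; apply: circulant_succ.
pose bip := @slot_bip n1 n2 d1.
have bip_l : forall i, #|[set j | bip i j]| = d1.
  by move=> i; apply: slot_bip_l.
have bip_r : forall j, #|[set i | bip i j]| = b.
  by move=> j; apply: slot_bip_r.
move=> cases; exists (glue bip h); split.
- exact: glue_two_degrees brE.
- have conn_r : (2 <= r) || (n2 <= r.+1) -> graph_connected (glue bip h).
    move=> big; apply: (glue_connected_r h_sym h_irr bip_l d1_gt0) => j k kE.
    by apply: connect1; rewrite glue_rr h_succ.
  case: cases => [big|big|[b_ge2 d1_ge2]|n11].
  + by apply: conn_r; rewrite big.
  + by apply: conn_r; rewrite big orbT.
  + apply: (glue_connected_r h_sym h_irr bip_l d1_gt0) => j k kE.
    have lt_jn : j.+1 < n2 by rewrite -kE.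
    have [p [p' [lt_p lt_p' pp' pj p'k]]] := slot_chain d1_gt0 n2_gt0 d1_ge2 b_ge2 lt_jn.
    have lt_i : p %/ d1 < n1 by rewrite ltn_divLR // -n2b.
    apply: (@connect_trans _ _ (lshift n2 (Ordinal lt_i))); apply: connect1.
      by rewrite glue_rl; apply/(slot_bipP d1_gt0 n2b); exists p.
    rewrite glue_lr; apply/(slot_bipP d1_gt0 n2b); exists p'; split=> //.
    by rewrite kE.
  + apply: (glue_connected_l h_sym h_irr bip_r b_gt0) => i k kE.
    by exfalso; have := ltn_ord k; rewrite kE => lt_i; lia.
- exact: (glue_extremal d1_neq_d2 bip_l bip_r h_r brE n2b).
Qed.

(** Here the second class is perfectly matched and each of its vertices has one
    neighbor in the first.  Contracting the edges between the classes turns the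
    matching edges into the edges of a [d1]-regular multigraph, with loops allowed,
    on the first class.  The second class is read as the set of slots, matched in
    blocks of two, and [slot_chain] makes the multigraph connected. *)
Lemma extremal_matching_graph : b = 1 -> r = 1 -> 2 <= d1 ->
  exists e : rel 'I_(n1 + n2),
    [/\ two_degrees d1 d2 e, graph_connected e & extremal_graph d1 e].
Proof.
move=> b1 r1 d1_ge2.
have n2E : n2 = n1 * d1 by rewrite -n2b b1 muln1.
have n2_even : ~~ odd n2 by move: n2r_even; rewrite r1 muln1.
pose bip (i : 'I_n1) (j : 'I_n2) := slot 2 n1 j == i.
pose h : rel 'I_n2 := fun j k => (j != k) && (j %/ 2 == k %/ 2).
have h_sym : symmetric h by move=> j k; rewrite /h eq_sym [_ %/ 2 == _]eq_sym.
have h_irr : irreflexive h by move=> j; rewrite /h eqxx.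
have h_1 j : #|[set k | h j k]| = 1.
  have lt_k : (if odd j then j.-1 else j.+1) < n2.
    have := ltn_ord j; have := odd_double_half n2; have := odd_double_half j.
    by rewrite (negbTE n2_even); case: (odd j) => /=; lia.
  apply/eqP/cards1P; exists (Ordinal lt_k); apply/setP => k.
  rewrite !inE /h !divn2 -!val_eqE /=.
  have := odd_double_half k; have := odd_double_half j.
  by case: (odd j); case: (odd k) => /=; lia.
have bip_r j : #|[set i | bip i j]| = b.
  rewrite b1; apply/eqP/cards1P; exists (Ordinal (slot_lt 2 n1_gt0 j)).
  by apply/setP => i; rewrite !inE -val_eqE eq_sym.
have bip_l i : #|[set j | bip i j]| = d1.
  have lt_n2 (k : 'I_d1) : slot_inv 2 n1 k i < n2 by rewrite n2E slot_inv_lt.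
  pose f (k : 'I_d1) : 'I_n2 := Ordinal (lt_n2 k).
  have f_inj : injective f.
    move=> k k' /(congr1 val) /= fk; apply: val_inj => /=.
    by rewrite -(slot_inv_div 2 n1_gt0 k i) fk slot_inv_div.
  rewrite -[RHS](card_ord d1) -cardsT -(card_imset _ f_inj).
  apply: eq_card => j; rewrite inE; apply/eqP/imsetP => [ji|[k _ ->]].
    have lt_d1 : j %/ n1 < d1 by rewrite ltn_divLR // mulnC -n2E.
    by exists (Ordinal lt_d1) => //; apply: val_inj; rewrite /= -ji slotK.
  exact: slot_invK.
have b1E : b + 1 = d2 by rewrite -r1 brE.
exists (glue bip h); split.
- exact: (glue_two_degrees h_sym h_irr d1_neq_d2 bip_l bip_r h_1 b1E).
- apply: (glue_connected_l h_sym h_irr bip_r b_gt0) => i k kE.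
  have lt_in : i.+1 < n1 by rewrite -kE.
  have [p [p' [lt_p lt_p' pp' pi p'k]]] := slot_chain (ltn0Sn 1) n1_gt0 (ltnSn 1) d1_ge2 lt_in.
  rewrite -n2E in lt_p lt_p'.
  apply: (@connect_trans _ _ (rshift n1 (Ordinal lt_p))).
    by apply: connect1; rewrite glue_lr /bip /= pi.
  apply: (@connect_trans _ _ (rshift n1 (Ordinal lt_p'))); apply: connect1.
    rewrite glue_rr /h /= pp' eqxx andbT -val_eqE /=.
    by apply/eqP => pE; move: p'k; rewrite -pE pi; lia.
  by rewrite glue_rl /bip /= p'k kE.
- exact: (glue_extremal d1_neq_d2 bip_l bip_r h_1 b1E n2b).
Qed.

Lemma extremal_connected_exists :
    case_a d1 d2 \/ case_b d1 n1 d2 n2 \/ case_c d1 n1 d2 n2 \/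
    case_d d1 n1 d2 n2 \/ case_e d1 n1 d2 n2 ->
  exists e : rel 'I_(n1 + n2),
    [/\ two_degrees d1 d2 e, graph_connected e & extremal_graph d1 e].
Proof.
case=> [[d1_ge2 d2_ge2]|[[n11 _ _ _]|[[n21 _ _ _]|[[d11 n22 d2_gt1 n1E]|[d11 _ ge2]]]]].
- have [r_ge2|r_lt2] := leqP 2 r.
    by apply: extremal_slot_graph; constructor 1.
  have [b_ge2|b_lt2] := leqP 2 b.
    by apply: extremal_slot_graph; constructor 3.
  have b1 : b = 1 by lia.
  by apply: extremal_matching_graph => //; lia.
- by apply: extremal_slot_graph; constructor 4.
- by apply: extremal_slot_graph; constructor 2; rewrite n21.
- apply: extremal_slot_graph; constructor 2.
  have bE : b = d2 - 1 by move: n2b; rewrite n22 d11 n1E muln1; lia.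
  by rewrite n22 /r bE; lia.
- apply: extremal_slot_graph; constructor 1.
  by rewrite -(leq_pmul2l n2_gt0) -n2r mulnC.
Qed.
End Construction.

(** * Connected minimizers *)

Theorem theorem6p5 (R : realType) (d1 n1 d2 n2 : nat)
    (n1_gt0 : (0 < n1)%N) (n2_gt0 : (0 < n2)%N)
    (d1_neq_d2 : d1 <> d2) (le_n1d1_n2d2 : (n1 * d1 <= n2 * d2)%N) :
  ((exists e : rel 'I_(n1 + n2),
      [/\ two_degrees d1 d2 e, graph_connected e
        & graph_spectral_radius R e = min_spectral_radius R d1 n1 d2 n2])
   <->
   (feasible d1 n1 d2 n2 /\
    (case_a d1 d2 \/ case_b d1 n1 d2 n2 \/ case_c d1 n1 d2 n2 \/
     case_d d1 n1 d2 n2 \/ case_e d1 n1 d2 n2)))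
  /\
  (forall e : rel 'I_(n1 + n2),
      two_degrees d1 d2 e -> graph_connected e ->
      graph_spectral_radius R e = min_spectral_radius R d1 n1 d2 n2 ->
      [/\ case_b d1 n1 d2 n2 ->
            (exists2 c, c \in degree_class e d1 & is_star e c),
          case_c d1 n1 d2 n2 ->
            (exists2 c, c \in degree_class e d2 & is_star e c),
          case_d d1 n1 d2 n2 ->
            (exists c1 c2, [/\ c1 \in degree_class e d2,
                               c2 \in degree_class e d2
                             & is_double_star e c1 c2])
        & case_e d1 n1 d2 n2 ->
            [/\ exists2 r, (2 <= r)%N & regular (induced e (degree_class e d2)) r,
                (n2 %| n1)%N
              & forall v, v \in degree_class e d2 ->
                  #|[set w in degree_class e d1 | e v w]%SET| = (n1 %/ n2)%N]]).
Proof.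
have d1_gt0_conn (e : rel 'I_(n1 + n2)) :
    two_degrees d1 d2 e -> graph_connected e -> 0 < d1.
  case=> _ c1 _ conn; have : 0 < #|degree_class e d1| by rewrite c1.
  case/card_gt0P=> v; rewrite inE => /eqP <-.
  by apply: connected_degree_gt0 => //; rewrite card_ord; lia.
split=> [|e e_deg conn rhoE]; last first.
  have d1_gt0 := d1_gt0_conn e e_deg conn.
  have := proj1 (graph_spectral_radius_minP n1_gt0 n2_gt0 d1_gt0 d1_neq_d2
                   le_n1d1_n2d2 e_deg R) rhoE.
  by move/extremal_shape; apply.
split=> [[e [e_deg conn rhoE]]|[feas cases]].
  have d1_gt0 := d1_gt0_conn e e_deg conn.
  have e_ext := proj1 (graph_spectral_radius_minP n1_gt0 n2_gt0 d1_gt0 d1_neq_d2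
                         le_n1d1_n2d2 e_deg R) rhoE.
  split; first by apply: extremal_feasible e_deg e_ext.
  by apply: extremal_connected_case e_deg e_ext conn.
have d1_gt0 : 0 < d1.
  case: cases => [[]|[[]|[[]|[[]|[]]]]]; lia.
have [e [e_deg conn e_ext]] := extremal_connected_exists n1_gt0 n2_gt0 d1_gt0
  d1_neq_d2 le_n1d1_n2d2 feas cases.
exists e; split=> //.
by apply/(graph_spectral_radius_minP n1_gt0 n2_gt0 d1_gt0 d1_neq_d2 le_n1d1_n2d2 e_deg R).
Qed.
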